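(* Let $1 \leq k < n$ be integers, let $x_1,\dots,x_k$ be linearly independent vectors in $\mathbb{Z}^n$, and let $\Omega = \operatorname{span}_{\mathbb{Z}}\{x_1,\dots,x_k\} \subset \mathbb{Z}^n$ be the sublattice of rank $k$ spanned by these vectors. Then there exists a sublattice $\Omega' \subseteq \mathbb{Z}^n$ of full rank $n$ which is an extension of $\Omega$ and satisfies $$\det \Omega' = \gcd(x_1 \wedge \dots \wedge x_k).$$ Further, if $k = n-1$, then there exists $y \in \mathbb{Z}^n$ so that $\Omega' = \operatorname{span}_{\mathbb{Z}}\{\Omega, y\}$ and $$\|y\| \leq \left\{ \left( \frac{\gcd(x_1 \wedge \dots \wedge x_k)}{\det \Omega} \right)^2 + \mu(\Omega)^2 \right\}^{1/2}.$$
   Context: A lattice of rank $m$ in $\mathbb{R}^n$ is $\Lambda = A\mathbb{Z}^m$ for a real $n \times m$ matrix $A$ of rank $m$ (a basis matrix); its determinant is $\det\Lambda = \sqrt{\det(A^\top A)}$. If $L \subset \Lambda$ is a sublattice of rank smaller than that of $\Lambda$, then $\Lambda$ is called an extension of $L$ if $\Lambda \cap \operatorname{span}_{\mathbb{R}} L = L$. The covering radius of a lattice $\Lambda$ is $\mu(\Lambda) = \min\{ r \in \mathbb{R} : \Lambda + B(r) = \operatorname{span}_{\mathbb{R}} \Lambda \}$, where $B(r)$ is the closed ball of radius $r$ centered at the origin in $\operatorname{span}_{\mathbb{R}}\Lambda$. The wedge product $x_1 \wedge \dots \wedge x_k$ is identified with the vector of Grassmann-Pl\''ucker coordinates in $\mathbb{R}^{\binom{n}{k}}$,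 i.e. the vector of determinants of all $k \times k$ submatrices of the $n \times k$ matrix $(x_1\ \dots\ x_k)$, and $\gcd(x_1 \wedge \dots \wedge x_k)$ is the (positive) greatest common divisor of these integer coordinates. The norm $\|\cdot\|$ is Euclidean. *)

(* Defs.v *)
From HB Require Import structures.
From mathcomp Require Import all_boot all_order all_algebra.
From mathcomp Require Import all_classical all_reals.

Set Implicit Arguments.
Unset Strict Implicit.
Unset Printing Implicit Defensive.

Import Order.TTheory GRing.Theory Num.Theory.
Local Open Scope classical_set_scope.
Local Open Scope ring_scope.

Section Spans.
Context {R : realType} {n : nat}.
Implicit Types (S : set 'cV[R]_n) (v : 'cV[R]_n).

Definition zspan S : set 'cV[R]_n :=
  [set v | exists m (s : m.-tuple 'cV[R]_n),
    (forall i, S (tnth s i)) /\ inIntSpan s v].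

Definition rspan S : set 'cV[R]_n :=
  [set v | exists m (s : m.-tuple 'cV[R]_n),
    (forall i, S (tnth s i)) /\ v \in <<s>>%VS].

(* The norm carried by the canonical normed structure on matrices is the sup
   norm, hence an explicit definition here. *)
Definition euclid_norm v : R := Num.sqrt (\sum_i v i 0 ^+ 2).

End Spans.

Section Lattices.
Context {R : realType} {n : nat}.

Definition int_vec (z : 'cV[int]_n) : 'cV[R]_n := map_mx intr z.

Definition integer_lattice : set 'cV[R]_n := range int_vec.

End Lattices.

Section LatticeInvariants.
Context {R : realType} {n : nat}.
Implicit Types L : set 'cV[R]_n.

Definition basis_matrix m L (A : 'M[R]_(n, m)) : Prop :=
  \rank A = m /\ L = [set A *m u | u in @integer_lattice R m].

Definition is_lattice m L : Prop := exists A : 'M[R]_(n, m), basis_matrix L A.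

(* Meaningful when [is_lattice m L]; see [lattice_detE] for the independence
   of the basis matrix. *)
Definition lattice_det m L : R :=
  let A := xget (0 : 'M[R]_(n, m)) [set A | basis_matrix L A] in
  Num.sqrt (\det (A^T *m A)).

Definition is_extension L L' : Prop :=
  exists m m', [/\ is_lattice m L, is_lattice m' L', (m < m')%N,
    L `<=` L' & L' `&` rspan L = L].

Definition span_ball L (r : R) : set 'cV[R]_n :=
  [set b | rspan L b /\ euclid_norm b <= r].

Definition covering_radii L : set R :=
  [set r | [set u + b | u in L & b in span_ball L r] = rspan L].

(* The minimum of [covering_radii L] (0 if there were none). *)
Definition covering_radius L : R :=
  xget 0 [set r | covering_radii L r /\ lbound (covering_radii L) r].

Lemma basis_matrix_change m L (A B : 'M[R]_(n, m)) :
  basis_matrix L A -> basis_matrix L B ->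
  exists U : 'M[int]_m, B = A *m map_mx intr U.
Proof.
move=> [_ LA] [_ LB].
have colB j : exists z : 'cV[int]_m, col j B = A *m map_mx intr z.
  have : L (col j B).
    rewrite LB; exists (delta_mx j 0); last by rewrite colE.
    exists (delta_mx j 0) => //.
    by apply/matrixP => a b; rewrite !mxE; case: (_ && _).
  by rewrite LA => -[_ [z _ <-] <-]; exists z.
have [f fE] := choice colB.
exists (\matrix_(i, j) f j i 0).
apply/matrixP => i j; have /matrixP /(_ i 0) := fE j.
by rewrite !mxE => ->; apply: eq_bigr => l _; rewrite !mxE.
Qed.

Lemma lattice_detE m L (A : 'M[R]_(n, m)) :
  basis_matrix L A -> lattice_det m L = Num.sqrt (\det (A^T *m A)).
Proof.
move=> bA; rewrite /lattice_det; case: xgetP => [B _ bB|/(_ A)//].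
have [U BE] := basis_matrix_change bA bB.
have [V AE] := basis_matrix_change bB bA.
have UV1 : map_mx intr U *m map_mx intr V = 1%:M :> 'M[R]_m.
  have fA : row_free A^T by rewrite /row_free mxrank_tr bA.1.
  apply: trmx_inj; apply: (row_free_inj fA).
  by rewrite -!trmx_mul mulmxA -BE -AE mulmx1.
have detUV1 : (\det U * \det V : int)%:~R = 1 :> R.
  by rewrite rmorphM /= -!det_map_mx -det_mulmx UV1 det1.
have U2 : \det U ^+ 2 = 1 :> int.
  have UVE : \det U * \det V = 1 :> int by apply: (@intr_inj R); rewrite detUV1.
  have : \det U \is a GRing.unit by apply/unitrPr; exists (\det V).
  by case/orP => /eqP ->.
rewrite BE trmx_mul -mulmxA (mulmxA A^T) !det_mulmx det_tr det_map_mx.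
by congr Num.sqrt; rewrite mulrCA -expr2 -rmorphXn /= U2 mulr1.
Qed.

End LatticeInvariants.

Arguments integer_lattice {R n}.

Section Wedge.
Context {n k : nat}.

Definition col_matrix (x : k.-tuple 'cV[int]_n) : 'M[int]_(n, k) :=
  \matrix_(i, j) tnth x j i 0.

(* The k-element sets of row indices are the strictly increasing k-tuples, as
   in [card_ltn_sorted_tuples]. *)
Definition wedge_coord (x : k.-tuple 'cV[int]_n) (t : k.-tuple 'I_n) : int :=
  \det (rowsub (tnth t) (col_matrix x)).

Definition wedge_gcd (x : k.-tuple 'cV[int]_n) : nat :=
  \big[gcdn/0%N]_(t : k.-tuple 'I_n | sorted ltn (map val t))
    `|wedge_coord x t|%N.

End Wedge.

(* Main.v *)
Require Import Defs.
From HB Require Import structures.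
From mathcomp Require Import all_boot all_order perm all_algebra.
From mathcomp Require Import all_classical all_reals.

Set Implicit Arguments.
Unset Strict Implicit.
Unset Printing Implicit Defensive.

Import Order.TTheory GRing.Theory Num.Theory.
Local Open Scope classical_set_scope.
Local Open Scope ring_scope.

(** Complete the n x k integer matrix X of the given vectors by integer columns
    Y to a square matrix (X | Y), and take for Omega' the lattice generated by
    all the columns.  The Smith normal form writes X = L D P with L and P
    unimodular; hence X = L1 M, where L1 is the block of the first k columns of
    L and M is k x k.  With Y the remaining columns of L, |det (X | Y)| = |det M|.
    Each k x k minor of X is a minor of L1 times det M, so det M divides their
    gcd; conversely M = N X for an integer matrix N (the first k rows of L^-1),
    and by the Cauchy-Binet expansion [det_mulmx_rowsub] det (N X) is an integer
    combination of the minors of X.  Thus |det (X | Y)| is the gcd of the minors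
    ([exists_completion]).  It is nonzero, since the Gram determinant of X has
    the form det (N X) too, so the columns of (X | Y) are independent; a point of
    Omega' in the span of X then has zero Y-coordinates and lies in Omega
    ([row_mx_extension]).

    For k = n - 1, Y is a single column y, which can be translated by Omega
    without changing det (X | y) or the lattice generated.  Split y = p + X c
    with p orthogonal to the columns of X.  Base times height for Gram
    determinants gives |p| = gcd / det Omega, and a translation brings the
    component X c within the covering radius of 0; Pythagoras concludes
    ([exists_short_translate]).  This uses that the covering radius is an
    attained minimum ([covering_radius_attained]), which rests on the existence
    of nearest points in nonempty sets of integer vectors. *)

(** * Minors of integer matrices *)

(** Cauchy-Binet without grouping the row selections f by their image:
    multilinearity of the determinant in the rows of N X. *)
Lemma det_mulmx_rowsub (R : comPzRingType) n k
    (N : 'M[R]_(k, n)) (X : 'M[R]_(n, k)) :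
  \det (N *m X) =
    \sum_(f : {ffun 'I_k -> 'I_n}) (\prod_i N i (f i)) * \det (rowsub f X).
Proof.
under [RHS]eq_bigr do rewrite big_distrr.
rewrite exchange_big /=; apply: eq_bigr => s _.
under eq_bigr do rewrite mxE.
rewrite bigA_distr_bigA big_distrr; apply: eq_bigr => f _ /=.
rewrite big_split mulrCA; congr (_ * (_ * _)).
by apply: eq_bigr => i _; rewrite mxE.
Qed.

(** The gcd runs over increasing row selections only.  A repeated row makes the
    minor vanish, and any other selection differs from an increasing one by a
    permutation, which changes only the sign. *)
Lemma wedge_gcd_dvd_minor n k (x : k.-tuple 'cV[int]_n) (f : 'I_k -> 'I_n) :
  ((wedge_gcd x)%:Z %| \det (rowsub f (col_matrix x)))%Z.
Proof.
have [/injectiveP f_inj|/injectivePn[i [j ij fij]]] := boolP (injectiveb f);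
  last first.
  rewrite (determinant_alternate ij) ?dvdz0// => l.
  by rewrite !mxE fij.
pose s := sort_tuple (fun a b : 'I_n => (a <= b)%N) [tuple f i | i < k].
have /tuple_permP[p sE] : perm_eq s [tuple f i | i < k] by rewrite perm_sort.
have stp i : tnth s i = f (p i).
  by rewrite (val_inj sE : s = _) !tnth_mktuple.
have s_lt : sorted ltn (map val s).
  rewrite ltn_sorted_uniq_leq map_inj_uniq; last exact: val_inj.
  rewrite sort_uniq map_inj_uniq ?enum_uniq//= sorted_map.
  by apply: sort_sorted => a b; exact: leq_total.
rewrite dvdzE; apply: (@biggcdn_inf _ s) => //; rewrite /wedge_coord.
have -> : rowsub (tnth s) (col_matrix x) = row_perm p (rowsub f (col_matrix x)).
  by apply/matrixP => i j; rewrite !mxE stp.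
by rewrite row_permE det_mulmx det_perm abszMsign.
Qed.

Lemma wedge_gcd_dvd_det n k (x : k.-tuple 'cV[int]_n) (N : 'M[int]_(k, n)) :
  ((wedge_gcd x)%:Z %| \det (N *m col_matrix x))%Z.
Proof.
rewrite det_mulmx_rowsub.
by apply: rpred_sum => f _; rewrite dvdz_mull ?wedge_gcd_dvd_minor.
Qed.

(** Y consists of the last m columns of the unimodular left factor in the Smith
    normal form of X. *)
Lemma exists_completion k m (x : k.-tuple 'cV[int]_(k + m)) :
  exists Y : 'M[int]_(k + m, m),
    `|\det (row_mx (col_matrix x) Y)|%N = wedge_gcd x.
Proof.
have [L uL [P uP [d _ XE]]] := int_Smith_normal_form (col_matrix x).
set D := (\matrix_(i, j) _) in XE.
have {XE}[M XE] : exists M : 'M_k, col_matrix x = lsubmx L *m M.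
  exists (usubmx D *m P); rewrite XE -{1}[L]hsubmxK -{1}[D]vsubmxK mul_row_col.
  rewrite (_ : dsubmx D = 0) ?mulmx0 ?addr0 ?mulmxA//.
  apply/matrixP => i j; rewrite !mxE.
  by case: eqP => //= E; have := ltn_ord j; rewrite -E ltnNge leq_addr.
exists (rsubmx L).
have -> : row_mx (col_matrix x) (rsubmx L) = L *m block_mx M 0 0 1%:M.
  by rewrite -{2}[L]hsubmxK mul_row_block XE !mulmx0 mulmx1 addr0 add0r.
have detL : `|\det L|%N = 1%N.
  by move: uL; rewrite unitmxE => /orP[]/eqP->.
rewrite det_mulmx det_lblock det1 mulr1 abszM detL mul1n.
apply/eqP; rewrite eqn_dvd; apply/andP; split.
  (* Each minor of X is a minor of the first k columns of L times det M. *)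
  apply/dvdn_biggcdP => t _; rewrite /wedge_coord XE.
  rewrite -mul_rowsub_mx det_mulmx abszM; exact: dvdn_mull.
(* Conversely M = N X, where N is the first k rows of L^-1. *)
have -> : M = usubmx (invmx L) *m col_matrix x.
  have : usubmx (invmx L *m L) *m col_mx M 0 = M.
    rewrite mulVmx// scalar_mx_block block_mxEv col_mxKu mul_row_col.
    by rewrite mul1mx mulmx0 addr0.
  move=> <-; rewrite -mul_usub_mx -mulmxA; congr (_ *m _).
  by rewrite -{1}[L]hsubmxK mul_row_col mulmx0 addr0 -XE.
exact: wedge_gcd_dvd_det.
Qed.

(** * Gram matrices and orthogonal projection *)

Lemma mxrank_inj (F : fieldType) n m (A : 'M[F]_(n, m)) :
  \rank A = m <-> forall u : 'cV_m, A *m u = 0 -> u = 0.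
Proof.
split=> [rA u Au0|A_inj].
  have fA : row_free A^T by rewrite /row_free mxrank_tr rA.
  apply/eqP; rewrite -trmx_eq0 -(mulmx_free_eq0 _ fA) -trmx_mul Au0.
  by rewrite trmx0.
rewrite -mxrank_tr; apply/eqP; rewrite -/(row_free _) -kermx_eq0.
apply/rowV0P => w /sub_kermxP wA0; rewrite -[w]trmxK.
by rewrite [w^T]A_inj ?trmx0// -[A]trmxK -trmx_mul wA0 trmx0.
Qed.

(** Adding combinations of the columns of X to Y is right multiplication by a
    unimodular matrix, so it changes neither determinants nor Gram
    determinants. *)
Lemma row_mx_shear (F : pzRingType) n k m (X : 'M[F]_(n, k)) (Y : 'M[F]_(n, m))
    (C : 'M[F]_(k, m)) :
  row_mx X (Y + X *m C) = row_mx X Y *m block_mx 1%:M C 0 1%:M.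
Proof. by rewrite mul_row_block !mulmx1 mulmx0 addr0 addrC. Qed.

Lemma det_shear (F : comPzRingType) k m (C : 'M[F]_(k, m)) :
  \det (block_mx 1%:M C 0 1%:M) = 1.
Proof. by rewrite det_ublock !det1 mulr1. Qed.

Section Euclid.
Context {R : realType}.

Lemma euclid_norm_ge0 n (v : 'cV[R]_n) : 0 <= euclid_norm v.
Proof. exact: sqrtr_ge0. Qed.

Lemma euclid_norm_sqr n (v : 'cV[R]_n) : euclid_norm v ^+ 2 = (v^T *m v) 0 0.
Proof.
rewrite sqr_sqrtr; last by apply: sumr_ge0 => i _; exact: sqr_ge0.
by rewrite mxE; apply: eq_bigr => i _; rewrite mxE expr2.
Qed.

Lemma euclid_norm_mono n (v w : 'cV[R]_n) :
  (forall i, `|v i 0| <= w i 0) -> euclid_norm v <= euclid_norm w.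
Proof.
move=> vw; apply: ler_wsqrtr; apply: ler_sum => i _.
by rewrite -real_normK ?num_real// lerXn2r ?nnegrE// (le_trans _ (vw i)).
Qed.

Lemma entry_le_euclid_norm n (v : 'cV[R]_n) i : `|v i 0| <= euclid_norm v.
Proof.
rewrite -sqrtr_sqr; apply: ler_wsqrtr.
by rewrite (bigD1 i)//= lerDl; apply: sumr_ge0 => j _; exact: sqr_ge0.
Qed.

Lemma euclid_norm_eq0 n (v : 'cV[R]_n) : euclid_norm v = 0 -> v = 0.
Proof.
move=> v0; apply/colP => i; rewrite mxE; apply/eqP.
by rewrite -normr_le0 -v0 entry_le_euclid_norm.
Qed.

(** If A^T A u = 0 then |A u|^2 = u^T A^T A u = 0, hence u = 0. *)
Lemma gram_unitmx n m (A : 'M[R]_(n, m)) : \rank A = m -> A^T *m A \in unitmx.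
Proof.
move=> rA; rewrite -row_free_unit; apply/eqP/mxrank_inj => u GU0.
apply: (mxrank_inj A).1 => //; apply: euclid_norm_eq0; apply/eqP.
by rewrite -sqrf_eq0 euclid_norm_sqr trmx_mul -mulmxA (mulmxA A^T) GU0 mulmx0 mxE.
Qed.

Lemma exists_orthogonal_projection n m (A : 'M[R]_(n, m)) (y : 'cV[R]_n) :
  \rank A = m -> exists c, A^T *m (y - A *m c) = 0.
Proof.
move=> /gram_unitmx uG; exists (invmx (A^T *m A) *m (A^T *m y)).
by rewrite mulmxBr !mulmxA mulmxV// mul1mx subrr.
Qed.

Lemma pythagoras n m (A : 'M[R]_(n, m)) (p : 'cV[R]_n) (c : 'cV[R]_m) :
  A^T *m p = 0 ->
  euclid_norm (p + A *m c) ^+ 2 = euclid_norm p ^+ 2 + euclid_norm (A *m c) ^+ 2.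
Proof.
move=> Ap0; have pA0 : p^T *m A = 0 by rewrite -[A]trmxK -trmx_mul Ap0 trmx0.
rewrite !euclid_norm_sqr [(p + _)^T]linearD/= mulmxDl !mulmxDr trmx_mul.
by rewrite (mulmxA p^T) pA0 -(mulmxA c^T _ p) Ap0 mul0mx mulmx0 addr0 add0r mxE.
Qed.

(** Squared volume = squared base * squared height: once the shear is removed,
    the Gram matrix is block diagonal. *)
Lemma det_gram_row_mx n m (A : 'M[R]_(n, m)) (p : 'cV[R]_n) (c : 'cV[R]_m) :
  A^T *m p = 0 ->
  \det ((row_mx A (p + A *m c))^T *m row_mx A (p + A *m c)) =
    \det (A^T *m A) * euclid_norm p ^+ 2.
Proof.
move=> Ap0; have pA0 : p^T *m A = 0 by rewrite -[A]trmxK -trmx_mul Ap0 trmx0.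
rewrite row_mx_shear trmx_mul -mulmxA (mulmxA _^T (row_mx A p)) !det_mulmx.
rewrite det_tr det_shear mul1r mulr1 tr_row_mx mul_col_row Ap0 pA0.
by rewrite det_ublock [in X in _ * X]det_mx11 euclid_norm_sqr.
Qed.

(** In codimension 1 the sign can be read off [det_gram_row_mx]: the Gram
    determinant times a square is det (A | y)^2 > 0.  The sign is what makes the
    squared lattice determinant equal to the Gram determinant, as the square root
    is 0 on negative numbers. *)
Lemma det_gram_hyperplane_ge0 k (A : 'M[R]_(k + 1, k)) :
  \rank A = k -> forall y, \det (row_mx A y) != 0 -> 0 <= \det (A^T *m A).
Proof.
move=> rA y; have [c pE] := exists_orthogonal_projection y rA.
have := det_gram_row_mx c pE; rewrite subrK det_mulmx det_tr -expr2 => dE.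
rewrite -sqrf_eq0 dE leNgt => d0; apply/negP => G0.
have := sqr_ge0 (\det (row_mx A y)).
rewrite le_eqVlt eq_sym dE (negPf d0)/= ltNge => /negP; apply.
by rewrite mulr_le0_ge0 ?sqr_ge0// ltW.
Qed.

(** * Lattices spanned by the columns of a matrix *)

Definition col_lattice n m (A : 'M[R]_(n, m)) : set 'cV[R]_n :=
  [set A *m u | u in integer_lattice].

Lemma col_latticeP n m (A : 'M[R]_(n, m)) v :
  col_lattice A v <-> exists z, v = A *m int_vec z.
Proof.
split=> [[_ [z _ <-] <-]|[z ->]]; first by exists z.
by exists (int_vec z) => //; exists z.
Qed.

Lemma mulmx_sum_col n m (A : 'M[R]_(n, m)) u : A *m u = \sum_j u j 0 *: col j A.
Proof.
apply/colP => i; rewrite summxE mxE; apply: eq_bigr => j _.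
by rewrite !mxE mulrC.
Qed.

Lemma col_lattice_col n m (A : 'M[R]_(n, m)) j : col_lattice A (col j A).
Proof.
apply/col_latticeP; exists (delta_mx j 0); rewrite colE; congr (_ *m _).
by apply/matrixP => a b; rewrite !mxE; case: (_ && _).
Qed.

Lemma zspan_col_lattice n m (A : 'M[R]_(n, m)) (S : set 'cV[R]_n) :
  S `<=` col_lattice A -> (forall j, S (col j A)) -> zspan S = col_lattice A.
Proof.
move=> SA AS; apply/seteqP; split=> v.
  move=> [l [s [Ss [a ->]]]]; apply/col_latticeP.
  elim/big_ind: _ => [|_ _ [z1 ->] [z2 ->]|i _].
  - by exists 0; rewrite /int_vec map_mx0 mulmx0.
  - by exists (z1 + z2); rewrite /int_vec map_mxD mulmxDr.
  have /SA/col_latticeP[z] := Ss i; rewrite (tnth_nth 0) => ->.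
  by exists (z *~ a i); rewrite /int_vec !raddfMz.
move=> /col_latticeP[z ->]; exists m, [tuple col j A | j < m]; split.
  by move=> j; rewrite tnth_mktuple.
exists [ffun j => z j 0]; rewrite mulmx_sum_col; apply: eq_bigr => j _.
by rewrite -tnth_nth tnth_mktuple ffunE mxE scaler_int.
Qed.

Lemma rspan_col_lattice n m (A : 'M[R]_(n, m)) :
  rspan (col_lattice A) = range (mulmx A).
Proof.
apply/seteqP; split=> v.
  move=> [l [s [Ss vs]]].
  have /subvP/(_ _ vs) : (<<s>> <= limg (linfun (mulmx A : 'cV_m -> 'cV_n)))%VS.
    apply/span_subvP => _ /tnthP[i ->].
    have /col_latticeP[z ->] := Ss i.
    by apply/memv_imgP; exists (int_vec z); rewrite ?memvf// lfunE.
  by move=> /memv_imgP[u _ ->]; exists u => //; rewrite lfunE.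
move=> [u _ <-]; exists m, [tuple col j A | j < m]; split.
  by move=> j; rewrite tnth_mktuple; exact: col_lattice_col.
rewrite mulmx_sum_col; apply: rpred_sum => j _; apply: rpredZ.
by apply: memv_span; apply/tnthP; exists j; rewrite tnth_mktuple.
Qed.

(** * The covering radius is attained *)

(** Integer vectors at distance at most d from v have entries bounded by
    |v| + d, so only finitely many candidates can be nearest. *)
Lemma exists_nearest_point n (S : set 'cV[R]_n) (v : 'cV[R]_n) :
  S `<=` integer_lattice -> S !=set0 ->
  exists2 w, S w & forall w', S w' -> euclid_norm (v - w) <= euclid_norm (v - w').
Proof.
move=> Sint [w0 Sw0].
set d := euclid_norm (v - w0).
have [N dN] : exists N : nat, euclid_norm v + d < N%:R.
  by eexists; apply: archi_boundP; rewrite addr_ge0 ?euclid_norm_ge0.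
(* A finite type covering the integer vectors with entries in [-N, N]. *)
pose decode (f : 'cV['I_(N + N).+1]_n) : 'cV[R]_n :=
  int_vec (map_mx (fun i : 'I_(N + N).+1 => i%:Z - N%:Z) f).
have decodeP w : S w -> euclid_norm (v - w) <= d -> exists f, w = decode f.
  move=> /Sint[z _ <-] vwd.
  exists (map_mx (fun a : int => inord (absz (a + N%:Z))) z).
  apply/colP => i; rewrite !mxE; congr intr.
  have zN : `|z i 0| < N%:Z.
    rewrite -(ltr_int R) intr_norm (le_lt_trans _ dN)//.
    have := entry_le_euclid_norm (v - int_vec z) i; rewrite !mxE => e1.
    have e2 := entry_le_euclid_norm v i.
    rewrite -[(z i 0)%:~R](subKr (v i 0)) (le_trans (ler_normB _ _))//.
    by rewrite lerD// (le_trans e1).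
  move: zN; rewrite ltr_norml => /andP[Nz zN].
  have zN0 : 0 <= z i 0 + N%:Z by rewrite -lerBlDr sub0r ltW.
  rewrite inordK; first by rewrite gez0_abs// addrK.
  by rewrite ltnS -lez_nat gez0_abs// PoszD lerD2r ltW.
have [f0 w0E] := decodeP w0 Sw0 (lexx _).
have Pf0 : `[< S (decode f0) >] by apply/asboolP; rewrite -w0E.
have [f /asboolP Sf fmin] :=
  @arg_minP _ _ _ f0 (fun f => `[< S (decode f) >])
    (fun f => euclid_norm (v - decode f)) Pf0.
exists (decode f) => // w Sw.
have [vw|/ltW vw] := leP (euclid_norm (v - w)) d.
  have [g gE] := decodeP w Sw vw; rewrite gE; apply: fmin.
  by apply/asboolP; rewrite -gE.
by apply: le_trans vw; rewrite /d w0E; exact: fmin.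
Qed.

(** Covering expressed in coordinates relative to A: rounding the real
    coordinate vector v to a suitable integer vector leaves an error of norm at
    most r. *)
Lemma covering_radiiP n m (A : 'M[R]_(n, m)) r :
  covering_radii (col_lattice A) r <->
  forall v, exists z, euclid_norm (A *m (v - int_vec z)) <= r.
Proof.
rewrite /covering_radii /span_ball rspan_col_lattice; split.
  move=> /seteqP[_ cov] v.
  have [|_ /col_latticeP[z ->] [b [_ br] bE]] := cov (A *m v); first by exists v.
  by exists z; rewrite mulmxBr -bE addrAC subrr add0r.
move=> cov; apply/seteqP; split.
  move=> _ [_ /col_latticeP[z ->] [_ [[u _ <-] _] <-]].
  by exists (int_vec z + u) => //; rewrite mulmxDr.
move=> _ [v _ <-]; have [z zr] := cov v.
exists (A *m int_vec z); first by apply/col_latticeP; exists z.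
exists (A *m (v - int_vec z)); first by split=> //; exists (v - int_vec z).
by rewrite -mulmxDr addrC subrK.
Qed.

(** Rounding down leaves coordinates in [0, 1), so the error is bounded
    entrywise by the row sums of |A|. *)
Lemma covering_radii_neq0 n m (A : 'M[R]_(n, m)) :
  covering_radii (col_lattice A) !=set0.
Proof.
exists (euclid_norm (\col_i \sum_j `|A i j|)); apply/covering_radiiP => v.
exists (map_mx Num.floor v); apply: euclid_norm_mono => i.
rewrite !mxE (le_trans (ler_norm_sum _ _ _))//; apply: ler_sum => j _.
rewrite !mxE normrM ler_piMr// ler_norml.
have /andP[fl fu] := Num.Theory.floor_itv (v j 0).
rewrite lerBlDl (le_trans _ (_ : 0 <= _)) ?lerN10 ?subr_ge0//=.
by rewrite ltW// -(intrD1).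
Qed.

(** The distance from a point to its nearest lattice point is a lower bound of
    all covering radii, hence at most their infimum; so the infimum itself
    covers. *)
Lemma covering_radius_attained n m (A : 'M[R]_(n, m)) :
  col_lattice A `<=` integer_lattice ->
  covering_radii (col_lattice A) (covering_radius (col_lattice A)).
Proof.
move=> Aint; set C := covering_radii _.
have C_lb : lbound C 0.
  move=> r /covering_radiiP/(_ 0)[z]; apply: le_trans; exact: euclid_norm_ge0.
have CA0 := covering_radii_neq0 A.
have infC : C (inf C).
  apply/covering_radiiP => v.
  have [] := @exists_nearest_point n (col_lattice A) (A *m v) Aint.
    by exists (A *m int_vec 0); apply/col_latticeP; exists 0.
  move=> _ /col_latticeP[z ->] zmin; exists z; apply: lb_le_inf => //.
  move=> r /covering_radiiP/(_ v)[z' z'r]; apply: le_trans z'r.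
  by rewrite !mulmxBr; apply: zmin; apply/col_latticeP; exists z'.
rewrite /covering_radius; case: xgetP => [r _ []//|/(_ (inf C))[]].
split=> //; apply: ge_inf; by exists 0.
Qed.

(** The component of y orthogonal to A is fixed by translations along the
    lattice, and its squared norm is the quotient of Gram determinants; the
    component in the span is reduced to within the covering radius. *)
Lemma exists_short_translate n m (A : 'M[R]_(n, m)) (y : 'cV[R]_n) :
  \rank A = m -> col_lattice A `<=` integer_lattice ->
  exists z : 'cV[int]_m,
    euclid_norm (y + A *m int_vec z) ^+ 2 <=
      \det ((row_mx A y)^T *m row_mx A y) / \det (A^T *m A) +
      covering_radius (col_lattice A) ^+ 2.
Proof.
move=> rA Aint; have [c pE] := exists_orthogonal_projection y rA.
set p := y - A *m c in pE.
have yE : y = p + A *m c by rewrite subrK.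
have [z zr] := (covering_radiiP A _).1 (covering_radius_attained Aint) c.
exists (- z); rewrite yE -addrA -mulmxDr /int_vec map_mxN pythagoras//.
have detG : \det (A^T *m A) != 0 by rewrite -unitfE -unitmxE gram_unitmx.
rewrite det_gram_row_mx// [X in X / _]mulrC mulfK// lerD2l.
by rewrite lerXn2r ?nnegrE ?(le_trans _ zr) ?euclid_norm_ge0.
Qed.

(** * Completing the given vectors to a full-rank lattice *)

Lemma mxrank_col_matrix n k (x : k.-tuple 'cV[int]_n) :
  free [seq int_vec v : 'cV[R]_n | v <- x] ->
  \rank (map_mx intr (col_matrix x) : 'M[R]_(n, k)) = k.
Proof.
move=> x_free; apply/mxrank_inj => u Xu0; apply/colP => j; rewrite mxE.
have /freeP/(_ (u^~ 0)) u0 : free [tuple of [seq int_vec v : 'cV[R]_n | v <- x]].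
  exact: x_free.
apply: u0.
rewrite -[RHS]Xu0 mulmx_sum_col; apply: eq_bigr => i _; congr (_ *: _).
by rewrite -tnth_nth tnth_map; apply/colP => a; rewrite !mxE.
Qed.

Lemma zspan_col_matrix n k (x : k.-tuple 'cV[int]_n) :
  @zspan R n [set int_vec v | v in [set` x]] =
    col_lattice (map_mx intr (col_matrix x)).
Proof.
have colE j : col j (map_mx intr (col_matrix x)) = int_vec (tnth x j) :> 'cV[R]_n.
  by apply/colP => a; rewrite !mxE.
apply: zspan_col_lattice => [_ [_ /tnthP[j ->] <-]|j]; last first.
  by rewrite colE; exists (tnth x j) => //; exact: mem_tnth.
by rewrite -colE; exact: col_lattice_col.
Qed.

Lemma col_lattice_int n m (A : 'M[int]_(n, m)) :
  col_lattice (map_mx intr A : 'M[R]_(n, m)) `<=` integer_lattice.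
Proof.
by move=> _ /col_latticeP[z ->]; rewrite -map_mxM; exists (A *m z).
Qed.

(** If all minors vanished, so would det (X^T X), which is nonzero for
    independent columns. *)
Lemma wedge_gcd_neq0 n k (x : k.-tuple 'cV[int]_n) :
  free [seq int_vec v : 'cV[R]_n | v <- x] -> wedge_gcd x != 0%N.
Proof.
move=> /mxrank_col_matrix/gram_unitmx; apply: contraL => /eqP g0.
have := wedge_gcd_dvd_det x (col_matrix x)^T; rewrite g0 dvd0z => /eqP d0.
by rewrite map_trmx -map_mxM unitmxE det_map_mx d0 unitr0.
Qed.

Lemma sqrt_det_gram n (A : 'M[int]_n) :
  Num.sqrt (\det ((map_mx intr A)^T *m map_mx intr A)) = (`|\det A|%N)%:R :> R.
Proof.
rewrite det_mulmx det_tr -expr2 sqrtr_sqr det_map_mx -intr_norm -abszE.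
by rewrite -pmulrn.
Qed.

(** The norm bound is stated under m = 1 so that a single completion serves both
    parts of the theorem. *)
Lemma exists_short_completion k m (x : k.-tuple 'cV[int]_(k + m)) :
  free [seq int_vec v : 'cV[R]_(k + m) | v <- x] ->
  let Omega : set 'cV[R]_(k + m) := zspan [set int_vec v | v in [set` x]] in
  exists2 Y : 'M[int]_(k + m, m),
    `|\det (row_mx (col_matrix x) Y)|%N = wedge_gcd x &
    m = 1%N -> forall j,
      euclid_norm (int_vec (col j Y) : 'cV[R]_(k + m)) <=
        Num.sqrt (((wedge_gcd x)%:R / lattice_det k Omega) ^+ 2 +
                  covering_radius Omega ^+ 2).
Proof.
move=> x_free Omega; have [Y YE] := exists_completion x.
have [m1|/eqP] := eqVneq m 1%N; last by exists Y.
subst m; have rX := mxrank_col_matrix x_free.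
have OmegaE : Omega = col_lattice (map_mx intr (col_matrix x)).
  exact: zspan_col_matrix.
have [z] := exists_short_translate (map_mx intr Y) rX (@col_lattice_int _ _ _).
rewrite -OmegaE -map_row_mx => yz; exists (Y + col_matrix x *m z).
  by rewrite row_mx_shear det_mulmx det_shear mulr1.
move=> _ j; rewrite ord1 col_id.
have -> : int_vec (Y + col_matrix x *m z) =
    map_mx intr Y + map_mx intr (col_matrix x) *m int_vec z :> 'cV[R]_(k + 1).
  by rewrite /int_vec map_mxD map_mxM.
rewrite -[leLHS]ger0_norm ?euclid_norm_ge0// -sqrtr_sqr ler_wsqrtr//.
apply: (le_trans yz); rewrite lerD2r le_eqVlt; apply/orP; left; apply/eqP.
rewrite (@lattice_detE _ _ _ _ (map_mx intr (col_matrix x))); last by split.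
rewrite expr_div_n -YE -sqrt_det_gram !sqr_sqrtr//.
  apply: det_gram_hyperplane_ge0 rX (map_mx intr Y) _.
  rewrite -map_row_mx det_map_mx intr_eq0 -absz_eq0 YE.
  exact: wedge_gcd_neq0 x_free.
by rewrite det_mulmx det_tr -expr2 sqr_ge0.
Qed.

(** Coordinates relative to independent columns are unique: a lattice point in
    the span of X has vanishing Y-coordinates and integer X-coordinates. *)
Lemma row_mx_extension n k m (X : 'M[R]_(n, k)) (Y : 'M[R]_(n, m)) :
  \rank (row_mx X Y) = (k + m)%N -> (0 < m)%N ->
  \rank X = k ->
  is_extension (col_lattice X) (col_lattice (row_mx X Y)).
Proof.
move=> rA m0 rX; exists k, (k + m)%N.
have XA : col_lattice X `<=` col_lattice (row_mx X Y).
  move=> _ /col_latticeP[z ->]; apply/col_latticeP; exists (col_mx z 0).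
  by rewrite /int_vec map_col_mx map_mx0 mul_row_col mulmx0 addr0.
split=> //; [by exists X|by exists (row_mx X Y)|by rewrite -addn1 leq_add2l|].
apply/seteqP; split=> [v [/col_latticeP[z ->]]|v Xv].
  rewrite rspan_col_lattice => -[u _ uE]; apply/col_latticeP.
  exists (usubmx z); rewrite -uE; congr (_ *m _).
  have /eqP : row_mx X Y *m (col_mx u 0 - int_vec z) = 0.
    by rewrite mulmxBr mul_row_col mulmx0 addr0 uE subrr.
  move=> /eqP/((mxrank_inj _).1 rA)/eqP; rewrite subr_eq0 => /eqP uz.
  by rewrite /int_vec map_usubmx -/(int_vec z) -uz col_mxKu.
split; first exact: XA.
by rewrite rspan_col_lattice; have /col_latticeP[z ->] := Xv; exists (int_vec z).
Qed.

End Euclid.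

Theorem theorem1p1 (R : realType) (n k : nat) (x : k.-tuple 'cV[int]_n) :
  (1 <= k)%N -> (k < n)%N ->
  free [seq int_vec v : 'cV[R]_n | v <- x] ->
  let Omega : set 'cV[R]_n := zspan [set int_vec v | v in [set` x]] in
  exists Omega' : set 'cV[R]_n,
    [/\ is_lattice n Omega' /\ Omega' `<=` integer_lattice,
        is_extension Omega Omega',
        lattice_det n Omega' = (wedge_gcd x)%:R &
        k = n.-1 ->
        exists y : 'cV[int]_n,
          Omega' = zspan (Omega `|` [set int_vec y]) /\
          euclid_norm (int_vec y : 'cV[R]_n) <=
            Num.sqrt (((wedge_gcd x)%:R / lattice_det k Omega) ^+ 2 +
                      covering_radius Omega ^+ 2)].
Proof.
move=> _ kn; have [m nE] : exists m, n = (k + m)%N.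
  by exists (n - k)%N; rewrite subnKC// ltnW.
subst n => x_free Omega; have m0 : (0 < m)%N by rewrite -addn1 leq_add2l in kn.
have [Y Ydet Yshort] := exists_short_completion x_free.
pose A : 'M[R]_(k + m) := map_mx intr (row_mx (col_matrix x) Y).
have AE : A = row_mx (map_mx intr (col_matrix x)) (map_mx intr Y).
  by rewrite -map_row_mx.
have rX := mxrank_col_matrix x_free.
have rA : \rank A = (k + m)%N.
  apply/eqP; rewrite -/(row_free _) row_free_unit unitmxE unitfE det_map_mx.
  by rewrite intr_eq0 -absz_eq0 Ydet (wedge_gcd_neq0 x_free).
have OmegaE : Omega = col_lattice (map_mx intr (col_matrix x)).
  exact: zspan_col_matrix.
have extA : is_extension Omega (col_lattice A).
  by rewrite OmegaE AE; apply: row_mx_extension => //; rewrite -AE.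
exists (col_lattice A); split=> //.
- by split; [exists A|exact: col_lattice_int].
- by rewrite (lattice_detE (A := A))// sqrt_det_gram Ydet.
move=> km; have m1 : m = 1%N.
  apply/(@addnI k); rewrite addn1 [in RHS]km prednK//.
  exact: leq_ltn_trans kn.
subst m; exists (col 0 Y); split; last exact: Yshort.
have colA (i : 'I_k) : col (lshift 1 i) A = col i (map_mx intr (col_matrix x)).
  by rewrite AE colKl.
have colY (i : 'I_1) : col (rshift k i) A = int_vec (col 0 Y).
  by rewrite AE colKr ord1 -map_col.
apply/esym/zspan_col_lattice => [v [|->]|j].
- by have [_ [_ [_ _ _ sub _]]] := extA; exact: sub.
- by rewrite -(colY 0); exact: col_lattice_col.
case: (split_ordP j) => i ->; [left|right]; last exact: colY.
by rewrite colA OmegaE; exact: col_lattice_col.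
Qed.
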